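(* Suppose a dynamic data structure problem has a solution (a data structure in the cell probe model with $w$-bit cells) with worst-case update time $t_u$ and worst-case query time $t_q$ (measured in cell probes). Then its static, fully persistent version with a total of $m$ updates has $(s, w, t)$-certificates for $s = O(m \cdot t_u)$ and $t = O(t_q)$, provided that $w = \Omega(\lg m)$.
   Context: A data structure problem is a function $f : \mathcal{Q} \times \mathcal{D} \to \mathcal{Z}$ (queries, databases, results). For a code $T : \mathcal{D} \to (\{0,1\}^w)^s$, write $T_d(i)$ for the $i$-th of the $s$ cells ($w$-bit strings) of $T(d)$, and for $P = \{i_1,\dots,i_k\} \subseteq \{1,\dots,s\}$ write $T_d(P)$ for the sequence $(i_1, T_d(i_1)),\dots,(i_k, T_d(i_k))$. The problem $f$ has $(s,w,t)$-certificates if there exist a code $T : \mathcal{D} \to (\{0,1\}^w)^s$ and a verifier $V$ such that for all $q \in \mathcal{Q}$, $d \in \mathcal{D}$ and all $P \subseteq \{1,\dots,s\}$ with $|P| = t$, either $V(q, T_d(P)) = f(q,d)$ or $V(q, T_d(P)) = \bot$ (with $\bot \notin \mathcal{Z}$), and for at least one such $P$, $V(q, T_d(P)) = f(q,d)$. Given a dynamic problem (supporting updates and queries), its static, fully persistent version is the following static data structure problem: the database is a rooted tree (the version tree) in which every node carries a sequence of update operations (the total number of updates over all nodes being $m$); queries are pairs $(q,u)$ with $q$ a query of the dynamic problem and $u$ a node of the version tree, and the answer is the result of executing $q$ after performing, starting from the initial state, the sequence of updates found on the path from the root to $u$ (in order).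
   Formalization: The version tree is assumed to have O(m) nodes (automatic if every node carries at least one update; the claim fails with unboundedly many update-free nodes), and memory cells are addressed by w-bit words, so the data structure has 2^w cells. *)

(* Defs.v *)
From mathcomp Require Import all_boot.

Set Implicit Arguments.
Unset Strict Implicit.
Unset Printing Implicit Defensive.

Definition word (w : nat) : Type := w.-tuple bool.

(* T_d(P); the cells are listed by increasing index. *)
Definition probed (s w : nat) (T : s.-tuple (word w)) (P : {set 'I_s}) :
    seq ('I_s * word w) :=
  [seq (i, tnth T i) | i <- enum P].

(* [None] is the value ⊥ of the verifier. *)
Definition has_certificates (Q D Z : Type) (f : Q -> D -> Z) (s w t : nat) :
    Prop :=
  exists (T : D -> s.-tuple (word w))
         (V : Q -> seq ('I_s * word w) -> option Z),
  forall (q : Q) (d : D),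
    (forall P : {set 'I_s}, #|P| = t ->
       V q (probed (T d) P) = Some (f q d) \/ V q (probed (T d) P) = None) /\
    (exists P : {set 'I_s},
       #|P| = t /\ V q (probed (T d) P) = Some (f q d)).

Record dynamic_problem := DynamicProblem {
  update : Type;
  query : Type;
  result : Type;
  state : Type;
  init_state : state;
  apply_update : state -> update -> state;
  answer : query -> state -> result
}.

(* Addresses are themselves words: the memory has 2 ^ w cells of w bits. *)
Definition memory (w : nat) : Type := word w -> word w.

(* Adaptive cell-probe algorithms: local computation is free and arbitrary, so
   an algorithm is a tree of probes branching on the contents that are read. *)
Inductive prog (w : nat) (A : Type) : Type :=
| Ret of A
| Read of word w & (word w -> prog w A)
| Write of word w & word w & prog w A.

Fixpoint exec (w : nat) (A : Type) (p : prog w A) (M : memory w) :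
    A * memory w :=
  match p with
  | Ret x => (x, M)
  | Read a k => exec (k (M a)) M
  | Write a c p' => exec p' [eta M with a |-> c]
  end.

Fixpoint probes (w : nat) (A : Type) (p : prog w A) (M : memory w) : nat :=
  match p with
  | Ret _ => 0
  | Read a k => (probes (k (M a)) M).+1
  | Write a c p' => (probes p' [eta M with a |-> c]).+1
  end.

Record data_structure (X : dynamic_problem) (w : nat) := DataStructure {
  init_memory : memory w;
  update_prog : update X -> prog w unit;
  query_prog : query X -> prog w (result X)
}.

Variant operation (X : dynamic_problem) : Type :=
| Update of update X
| Query of query X.

Definition state_step (X : dynamic_problem) (x : state X) (o : operation X) :
    state X :=
  match o with
  | Update u => apply_update x u
  | Query _ => x
  end.

(* A query does not change the abstract state, but it may write to memory. *)
Definition memory_step (X : dynamic_problem) (w : nat)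
    (S : data_structure X w) (M : memory w) (o : operation X) : memory w :=
  match o with
  | Update u => (exec (update_prog S u) M).2
  | Query q => (exec (query_prog S q) M).2
  end.

(* Correctness and probe bounds are required in every memory that arises from
   the initial one by an arbitrary interleaving of updates and queries. *)
Definition solves (X : dynamic_problem) (w : nat) (S : data_structure X w)
    (tu tq : nat) : Prop :=
  forall ops : seq (operation X),
    let M := foldl (memory_step S) (init_memory S) ops in
    let x := foldl (@state_step X) (init_state X) ops in
    (forall u : update X, probes (update_prog S u) M <= tu) /\
    (forall q : query X,
       probes (query_prog S q) M <= tq /\
       (exec (query_prog S q) M).1 = answer q x).

(* Rooted trees on the node set N, given by parent pointers; by convention the
   root is its own parent. *)
Record version_tree (N : finType) (U : Type) := VersionTree {
  root : N;
  parent : N -> N;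
  updates : N -> seq U;
  parent_root : parent root = root;
  root_reachable : forall v : N, fconnect parent v root
}.

(* [findex] counts the steps from v up to the first visit of the root. *)
Definition root_path (N : finType) (U : Type) (d : version_tree N U) (v : N) :
    seq N :=
  rev (traject (parent d) v (findex (parent d) v (root d)).+1).

Definition path_updates (N : finType) (U : Type) (d : version_tree N U)
    (v : N) : seq U :=
  flatten [seq updates d x | x <- root_path d v].

Definition total_updates (N : finType) (U : Type) (d : version_tree N U) : nat :=
  \sum_(v : N) size (updates d v).

Definition persistent (X : dynamic_problem) (N : finType) (m : nat)
    (q : query X * N)
    (d : {d : version_tree N (update X) | total_updates d = m}) : result X :=
  answer q.1 (foldl (@apply_update X) (init_state X) (path_updates (sval d) q.2)).

Arguments persistent : clear implicits.

(* Main.v *)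
Require Import Defs.
From mathcomp Require Import all_boot zify.
From Stdlib Require Import ClassicalEpsilon.

Set Implicit Arguments.
Unset Strict Implicit.
Unset Printing Implicit Defensive.

(** List the nodes of the version tree in preorder. For a fixed address, the
    content of the cell changes along this list only when a node that writes to
    it is entered or left, so in the lexicographic order on (address, version)
    the whole history is piecewise constant, with at most [2 m tu + 1] pieces.
    The code stores each piece (endpoints and value) in O(1) words, together with
    the preorder position of every node. A query is certified by the position of
    its node and, for every cell it reads, the piece that contains this cell at
    that position. *)

(** * Certificates from small determining sets of cells *)

Lemma subset_card_extend (I : finType) (A : {set I}) (t : nat) :
  #|A| <= t <= #|I| -> exists2 B : {set I}, A \subset B & #|B| = t.
Proof.
case/andP; elim: t => [|t IHt]; first by rewrite leqn0 => /eqP A0 _; exists A.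
rewrite leq_eqVlt => /orP[/eqP At _|At tI]; first by exists A.
have [B AB Bt] := IHt At (ltnW tI).
have /card_gt0P[x] : 0 < #|~: B| by have := cardsC B; lia.
rewrite inE => xB; exists (x |: B); last by rewrite cardsU1 xB Bt.
exact: subset_trans AB (subsetUr _ _).
Qed.

Lemma injection_of_card_le (R U : finType) :
  #|R| <= #|U| -> exists g : R -> U, injective g.
Proof.
move=> RU; exists (fun x => enum_val (widen_ord RU (enum_rank x))) => x y.
by move=> /enum_val_inj/(congr1 val) /= /val_inj /enum_rank_inj.
Qed.

Lemma probed_inj (s w : nat) (T T' : s.-tuple (word w)) (P P' : {set 'I_s}) :
  probed T' P' = probed T P -> P' = P /\ {in P, tnth T' =1 tnth T}.
Proof.
move=> eqT; have eP : enum P' = enum P.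
  by have := congr1 (map fst) eqT; rewrite /probed -!map_comp !map_id.
have PP : P' = P by apply/setP=> i; rewrite -mem_enum eP mem_enum.
split=> // i iP; move: eqT; rewrite /probed eP => /eq_in_map/(_ i).
by rewrite mem_enum iP => /(_ isT) [].
Qed.

(* The verifier answers as soon as all databases consistent with the probed
   cells agree on the answer, so only completeness has to be arranged. *)
Lemma certificates_of_determining (Q D Z : Type) (f : Q -> D -> Z) (w k : nat)
    (J : finType) (T : D -> J -> word w) :
  (forall q d, exists2 P : {set J}, #|P| <= k
     & forall d', {in P, T d' =1 T d} -> f q d' = f q d) ->
  exists2 t, t <= k & has_certificates f #|J| w t.
Proof.
(* A certificate has exactly [t] cells, so [t] is capped at the number of cells; smaller determining
   sets are padded up to [t]. *)
move=> detT; exists (minn k #|J|); first exact: geq_minl.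
set t := minn _ _.
pose T' d := [tuple T d (enum_val i) | i < #|J|].
pose agree q l z := forall d (P : {set 'I_#|J|}),
  #|P| = t -> probed (T' d) P = l -> f q d = z.
exists T', (fun q l => match excluded_middle_informative (ex (agree q l)) with
  | left H => Some (sval (constructive_indefinite_description _ H))
  | right _ => None end) => q d; split.
  move=> P Pt; case: excluded_middle_informative => [H|_]; last by right.
  by case: constructive_indefinite_description => z zP; left; rewrite (zP d P).
have [P0 P0k detP] := detT q d.
pose P1 : {set 'I_#|J|} := [set enum_rank x | x in P0].
have [|P P1P Pt] := @subset_card_extend _ P1 t.
  rewrite card_ord geq_minr andbT leq_min card_imset; last exact: enum_rank_inj.
  by rewrite P0k max_card.
exists P; split=> //; case: excluded_middle_informative => [H|[]].
  by case: constructive_indefinite_description => z zP; rewrite (zP d P).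
exists (f q d) => d' P' _ /probed_inj[_ eqT]; apply: detP => x xP.
have /eqT : enum_rank x \in P.
  by apply: (subsetP P1P); apply/imsetP; exists x.
by rewrite !tnth_mktuple enum_rankK.
Qed.

(** By the cardinality bound, records embed injectively into [k]-tuples of words. Probing all [k]
    words of a record therefore reveals it, and [c] records cost [c * k] cells. *)
Lemma certificates_of_records (Q D Z : Type) (f : Q -> D -> Z) (w k c : nat)
    (I R : finType) (T : D -> I -> R) :
  #|R| <= 2 ^ (k * w) ->
  (forall q d, exists2 l : seq I, size l <= c
     & forall d', {in l, T d' =1 T d} -> f q d' = f q d) ->
  exists2 t, t <= c * k & has_certificates f (#|I| * k) w t.
Proof.
move=> Rk detT.
have [|g g_inj] := @injection_of_card_le R (k.-tuple (word w)).
  by rewrite !card_tuple card_bool -expnM mulnC.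
pose T' d (x : I * 'I_k) := tnth (g (T d x.1)) x.2.
have -> : #|I| * k = #|{: I * 'I_k}| by rewrite card_prod card_ord.
apply: (@certificates_of_determining _ _ _ _ _ _ _ T') => q d.
have [l lc detl] := detT q d.
exists (setX [set i in l] [set: 'I_k]).
  rewrite cardsX cardsT card_ord leq_mul2r; apply/orP; right.
  by apply: leq_trans lc; rewrite cardsE card_size.
move=> d' eqT; apply: detl => i il; apply/g_inj/eq_from_tnth => j.
by apply: (eqT (i, j)); rewrite !inE il.
Qed.

(** * Hamming distance and the cost of tours through memories *)

Section Dist.
Variables (A : finType) (C : eqType).
Implicit Types f g h : A -> C.

Definition dist f g : nat := \sum_a (f a != g a).

Lemma distC f g : dist f g = dist g f.
Proof. by apply: eq_bigr => a _; rewrite eq_sym. Qed.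

Lemma distxx f : dist f f = 0.
Proof. by apply: big1 => a _; rewrite eqxx. Qed.

Lemma dist_triangle g f h : dist f h <= dist f g + dist g h.
Proof.
rewrite /dist -big_split leq_sum // => a _.
case: eqP => //= fh; case: eqP => //= fg; case: eqP => // gh.
by case: fh; rewrite fg.
Qed.

Lemma dist_eq0 f g : dist f g = 0 -> f =1 g.
Proof.
move/eqP; rewrite sum_nat_eq0 => /forallP fg a; apply/eqP.
by have := fg a; rewrite eqb0 negbK.
Qed.

Lemma dist_update f a c : dist f [eta f with a |-> c] <= 1.
Proof.
rewrite /dist (bigD1 a) //= big1 ?addn0 ?leq_b1 // => b /negPf ba.
by rewrite /= ba eqxx.
Qed.

Variable z : A -> C.

(** The walk always ends at [z], so a walk that starts at [z] is closed. The return to [z] will pay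
    for the passage from one address block to the next. *)
Fixpoint tour_cost f (s : seq (A -> C)) : nat :=
  if s is g :: s' then dist f g + tour_cost g s' else dist f z.

Lemma tour_cost_sum f s :
  tour_cost f s =
  \sum_(0 <= j < (size s).+1) dist (nth z (f :: s) j) (nth z (f :: s) j.+1).
Proof.
elim: s f => [|g s IHs] f /=; first by rewrite big_nat1.
by rewrite big_nat_recl // IHs.
Qed.

Lemma tour_cost_head f g s : tour_cost f s <= dist f g + tour_cost g s.
Proof.
case: s => [|h s] /=; first exact: dist_triangle.
by rewrite addnA leq_add2r dist_triangle.
Qed.

(** The new walk costs at most as much as the old one with a detour from [g] to [h] and back. *)
Lemma tour_cost_insert f s1 g h s2 :
  tour_cost f (s1 ++ g :: h :: s2) <=
  tour_cost f (s1 ++ g :: s2) + (dist g h).*2.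
Proof.
elim: s1 f => [|k s IHs] f /=; last by have := IHs k; lia.
by have := tour_cost_head h g s2; rewrite (distC h g); lia.
Qed.

End Dist.

(* Inserting each node right after its parent gives a preorder; by the triangle
   inequality every tree edge is paid for at most twice. *)
Lemma tree_tour (N A : finType) (C : eqType) (par : N -> N) (r : N)
    (M : N -> A -> C) (z : A -> C) (c : N -> nat) :
  (forall v, fconnect par v r) ->
  dist z (M r) <= c r ->
  (forall v, v != r -> dist (M (par v)) (M v) <= c v) ->
  exists e : seq N, [/\ size e = #|N|, forall v, v \in e
    & tour_cost z z (map M e) <= (\sum_v c v).*2].
Proof.
move=> reach cr cP.
(* The list grows by one node at a time, and only the nodes already listed are charged. *)
suff H k : k < #|N| -> exists e : seq N, [/\ uniq e, size e = k.+1, r \in e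
    & tour_cost z z (map M e) <= (\sum_(v <- e) c v).*2].
  have N0 : 0 < #|N| by apply/card_gt0P; exists r.
  have [|e [Ue se _ ce]] := H #|N|.-1; first by rewrite ltn_predL.
  rewrite prednK // in se.
  have eqc : #|e| = #|N| by rewrite (card_uniqP Ue).
  have eT : e =i N by apply/(subset_cardP eqc)/subsetP.
  exists e; split=> //.
  by rewrite big_uniq // (eq_bigl _ _ eT) in ce.
elim: k => [_|k IHk kN].
  (* The initial content [z] acts as a parent of the root: going to [M r] and back costs at most
     twice [c r]. *)
  by exists [:: r]; rewrite big_seq1 /= inE (distC (M r)) addnn leq_double.
have [e [Ue se re ce]] := IHk (ltnW kN).
have [u ue] : exists u, u \notin e.
  apply/existsP; rewrite -negb_forall; apply/negP => /forallP eT.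
  move: kN; rewrite -se -(card_uniqP Ue) ltnNge subset_leq_card //.
  exact/subsetP.
have : iter (findex par u r) par u \in e by rewrite iter_findex.
(* On the way from [u] up to the root, the last node before the first entry into [e] has its parent
   in [e]; this is the node to insert. *)
move: (findex par u r) => i; elim: i u ue => [|i IHi] u ue /=; first by rewrite (negPf ue).
rewrite -iterS iterSr; case: (boolP (par u \in e)) => [pe _|]; last exact: IHi.
have ur : u != r by apply: contraNneq ue => ->.
case/splitPr: pe Ue se re ce ue => e1 e2 Ue se re ce ue.
have P : perm_eq (e1 ++ par u :: u :: e2) (u :: e1 ++ par u :: e2).
  by apply/permP => x; rewrite /= !count_cat /=; lia.
exists (e1 ++ par u :: u :: e2); split.
- by rewrite (perm_uniq P) /= ue.
- by rewrite (perm_size P) /= se.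
- by rewrite (perm_mem P) inE re orbT.
rewrite (perm_big _ P) big_cons doubleD map_cat /=.
apply: leq_trans (tour_cost_insert _ _ _ _ _ _) _.
by rewrite map_cat /= in ce; have := cP u ur; lia.
Qed.

(** * Piecewise constant histories *)

Lemma interval_pieces (V : eqType) (h : nat -> V) (n : nat) :
  exists s : seq (nat * nat * V),
    [/\ size s <= (\sum_(0 <= x < n) (h x != h x.+1)).+1,
        forall p, p \in s -> [/\ p.1.1 <= n, p.1.2 <= n
          & forall x, p.1.1 <= x <= p.1.2 -> h x = p.2]
      & forall x, x <= n -> exists2 p, p \in s & p.1.1 <= x <= p.1.2].
Proof.
(* Strengthened so that the head of the list is the piece ending at [n]. The induction step extends
   it to [n.+1], or opens a new piece that is paid for by a change of [h]. *)
suff [l [s [ss sP sc]]] : exists l s,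
    [/\ size ((l, n, h n) :: s) <= (\sum_(0 <= x < n) (h x != h x.+1)).+1,
        forall p, p \in (l, n, h n) :: s -> [/\ p.1.1 <= n, p.1.2 <= n
          & forall x, p.1.1 <= x <= p.1.2 -> h x = p.2]
      & forall x, x <= n ->
          exists2 p, p \in (l, n, h n) :: s & p.1.1 <= x <= p.1.2].
  by exists ((l, n, h n) :: s).
elim: n => [|n [l [s [ss sP sc]]]].
  exists 0, [::]; split=> // [p|x x0].
    by rewrite inE => /eqP-> /=; split=> // x; rewrite leqn0 => /eqP->.
  by exists (0, 0, h 0) => //=; rewrite inE.
have [/= ln _ lP] := sP _ (mem_head _ _).
rewrite big_nat_recr //=; case: (eqVneq (h n) (h n.+1)) => [hn|hn].
  exists l, s; split; first by rewrite addn0.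
    move=> p; rewrite inE => /orP[/eqP->|ps] /=.
      split=> // [|x]; first exact: leqW.
      by case: (eqVneq x n.+1) => [->//|? ?]; rewrite -hn lP //; lia.
    have [|p1 p2 pP] := sP p; first by rewrite inE ps orbT.
    by split=> //; apply: leqW.
  move=> x xn; case: (leqP l x) => lx.
    by exists (l, n.+1, h n.+1); rewrite ?inE ?eqxx //= lx.
  have [|p] := sc x; first by lia.
  rewrite inE => /orP[/eqP-> /=|ps px]; first by lia.
  by exists p; rewrite ?inE ?ps ?orbT.
exists n.+1, ((l, n, h n) :: s); split; first by move: ss => /=; lia.
  move=> p; rewrite inE => /orP[/eqP->|ps] /=.
    by split=> // x xn; congr h; lia.
  by have [p1 p2 pP] := sP p ps; split=> //; apply: leqW.
move=> x xn; case: (eqVneq x n.+1) => [->|xn'].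
  by exists (n.+1, n.+1, h n.+1); rewrite ?inE ?eqxx //= leqnn.
have [|p ps px] := sc x; first by lia.
by exists p; rewrite // inE ps orbT.
Qed.

(* Cell [a] at tour position [j] gets the linear coordinate [a * n + j]. Values
   equal to the initial content are coded by [None], hence all blocks start with
   [None] and moving to the next block costs no more than returning to [z]. *)
Lemma memory_pieces (N A : finType) (C : eqType) (par : N -> N) (r : N)
    (M : N -> A -> C) (z : A -> C) (c : N -> nat) (n := #|N|.+1) :
  (forall v, fconnect par v r) ->
  dist z (M r) <= c r ->
  (forall v, v != r -> dist (M (par v)) (M v) <= c v) ->
  exists (pos : N -> nat) (s : seq (nat * nat * option C)),
    [/\ forall v, pos v < n,
        size s <= (\sum_v c v).*2.+1,
        forall p, p \in s -> [/\ p.1.1 <= #|A| * n, p.1.2 <= #|A| * n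
          & forall v (a : A), p.1.1 <= enum_rank a * n + pos v <= p.1.2 ->
              M v a = odflt (z a) p.2]
      & forall v (a : A), exists2 p, p \in s
          & p.1.1 <= enum_rank a * n + pos v <= p.1.2].
Proof.
move=> reach cr cP; have [e [se eT ce]] := tree_tour reach cr cP.
have [a0 _|A0] := pickP A; last first.
  exists (fun=> 0), [::]; split=> // v a; by have := A0 a.
(* Position 0 holds the initial content and the node of index [i] in [e] has position [i.+1], hence
   [n] positions per block. *)
pose m j := nth z (z :: map M e) j.
pose code j a := if m j a == z a then None else Some (m j a).
pose h x := code (x %% n) (nth a0 (enum A) (x %/ n)).
have mP v : m (index v e).+1 = M v.
  by rewrite /m /= (nth_map r) ?index_mem ?nth_index.
have hE (a : A) j : j < n -> h (enum_rank a * n + j) = code j a.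
  move=> jn; rewrite /h modnMDl modn_small // divnMDl // divn_small // addn0.
  by rewrite -/(enum_rank a) -enum_val_nth enum_rankK.
have posP v : (index v e).+1 < n by rewrite ltnS -se index_mem.
have [s [ss sP sc]] := interval_pieces h (#|A| * n).
exists (fun v => (index v e).+1), s; split=> //.
- apply: leq_trans ss _; rewrite ltnS; apply: leq_trans ce.
  (* Exchanging the sums over tour steps and addresses matches the tour cost, address by address,
     with the blocks of [h]. *)
  rewrite tour_cost_sum size_map se exchange_big /= big_nat_mul.
  rewrite -[X in _ <= X]big_enum /= (big_nth a0) -cardE.
  apply: leq_sum => i _; rewrite -{1}[i * n]add0n big_addn.
  rewrite mulSn addnK; rewrite !big_nat; apply: leq_sum => j /= jn.
  set a := nth a0 _ i; rewrite -/(m j.+1) -/(m j).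
  have [mj|_] := eqVneq (m j a) (m j.+1 a); last exact: leq_b1.
  rewrite leqn0 eqb0 negbK; apply/eqP.
  rewrite -addSn [j + _]addnC [j.+1 + _]addnC.
  have -> : h (i * n + j) = code j a.
    by rewrite /h modnMDl modn_small // divnMDl // divn_small // addn0.
  have [j1n|nj1] := ltnP j.+1 n.
    rewrite /h modnMDl modn_small // divnMDl // divn_small // addn0 -/a.
    by rewrite /code mj.
  (* Last step of a block: [m n] is the default [z]. If the cell does not change there, it already
     holds its initial content, coded by [None] like the start of the next block. *)
  have -> : j.+1 = n by lia.
  rewrite /h modnMDl modnn /code eqxx mj /m nth_default ?eqxx //=.
  by rewrite size_map se.
- move=> p ps; have [p1 p2 pP] := sP p ps; split=> // v a /pP.
  by rewrite hE // /code mP => <-; case: eqP.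
move=> v a; apply: sc; have := ltn_ord (enum_rank a); have := posP v.
move: (_.+1) (enum_rank a : nat) => j i jn iA.
apply: leq_trans (leq_mul iA (leqnn n)); by rewrite mulSn addnC leq_add2r ltnW.
Qed.

(** * Cell-probe programs: cells changed and cells read *)

Section Programs.
Variables (w : nat).

Lemma dist_exec (B : Type) (p : prog w B) (M : memory w) :
  dist M (exec p M).2 <= probes p M.
Proof.
elim: p M => [x|a k IHk|a c p IHp] M /=; first by rewrite distxx.
  exact: leqW (IHk _ _).
apply: leq_trans (dist_triangle [eta M with a |-> c] _ _) _.
by rewrite -add1n leq_add ?dist_update.
Qed.

(** The list consists of the addresses read in [M]: agreement there forces the same branch at every
    read. A write adds no address, since it stores the same word in both memories. *)
Lemma exec_determined (B : Type) (p : prog w B) (M : memory w) :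
  exists2 l : seq (word w), size l <= probes p M
    & forall M', {in l, M' =1 M} -> (exec p M').1 = (exec p M).1.
Proof.
elim: p M => [x|a k IHk|a c p IHp] M /=; first by exists [::].
  have [l lP lM] := IHk (M a) M; exists (a :: l) => // M' eqM.
  rewrite eqM ?mem_head //; apply: lM => b bl; apply: eqM.
  by rewrite inE bl orbT.
have [l lP lM] := IHp [eta M with a |-> c]; exists l; first exact: leqW.
by move=> M' eqM; apply: lM => b bl /=; rewrite eqM.
Qed.

End Programs.

(** * Update sequences along the version tree *)

Section Versions.
Variables (N : finType) (U : Type) (d : version_tree N U).

Lemma path_updates_root : path_updates d (Defs.root d) = updates d (Defs.root d).
Proof. by rewrite /path_updates /root_path findex0 /= cats0. Qed.

Lemma path_updates_parent (v : N) : v != Defs.root d ->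
  path_updates d v = path_updates d (parent d v) ++ updates d v.
Proof.
rewrite eq_sym /path_updates /root_path => vr.
rewrite (fconnect_findex (root_reachable d v) vr).
by rewrite trajectS rev_cons map_rcons flatten_rcons.
Qed.

Lemma path_updates_nil (v : N) : total_updates d = 0 -> path_updates d v = [::].
Proof.
move=> /eqP; rewrite sum_nat_eq0 => /forallP d0; rewrite /path_updates.
by elim: (root_path d v) => //= x s ->; have := d0 x; case: (updates d x).
Qed.

End Versions.

(** * Memories of the versions and their certificates *)

Section Solution.
Variables (X : dynamic_problem) (w tu tq : nat) (S : data_structure X w).
Hypothesis solS : solves S tu tq.

Definition run_updates (us : seq (update X)) : memory w :=
  foldl (fun M u => (exec (update_prog S u) M).2) (init_memory S) us.

Lemma foldl_memory_step (us : seq (update X)) :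
  foldl (memory_step S) (init_memory S) (map (@Update X) us) = run_updates us.
Proof. by rewrite /run_updates; elim: us (init_memory S) => /=. Qed.

Lemma foldl_state_step (us : seq (update X)) :
  foldl (@state_step X) (init_state X) (map (@Update X) us) =
  foldl (@apply_update X) (init_state X) us.
Proof. by elim: us (init_state X) => /=. Qed.

Lemma probes_update (us : seq (update X)) (u : update X) :
  probes (update_prog S u) (run_updates us) <= tu.
Proof.
by rewrite -foldl_memory_step; have [H _] := solS (map (@Update X) us); apply: H.
Qed.

Lemma run_query (us : seq (update X)) (q : query X) :
  probes (query_prog S q) (run_updates us) <= tq /\
  (exec (query_prog S q) (run_updates us)).1 =
    answer q (foldl (@apply_update X) (init_state X) us).
Proof.
rewrite -foldl_memory_step -foldl_state_step.
by have [_ H] := solS (map (@Update X) us); apply: H.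
Qed.

Lemma dist_run_updates (us vs : seq (update X)) :
  dist (run_updates us) (run_updates (us ++ vs)) <= size vs * tu.
Proof.
elim/last_ind: vs => [|vs u IHvs]; first by rewrite cats0 distxx.
rewrite -rcons_cat size_rcons mulSn addnC.
apply: leq_trans (dist_triangle (run_updates (us ++ vs)) _ _) (leq_add IHvs _).
apply: leq_trans (probes_update (us ++ vs) u).
by rewrite {2}/run_updates foldl_rcons dist_exec.
Qed.

Definition version_memory (N : finType) (d : version_tree N (update X)) (v : N) :=
  run_updates (path_updates d v).

Lemma persistentE (N : finType) (m : nat) (q : query X) (v : N)
    (d : {d : version_tree N (update X) | total_updates d = m}) :
  persistent X N m (q, v) d =
  (exec (query_prog S q) (version_memory (sval d) v)).1.
Proof. by rewrite (run_query _ q).2. Qed.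

(* Either all memories that arise are equal, or queries ignore them. *)
Lemma degenerate_certificates (N : finType) (m : nat) :
  [|| m == 0, tu == 0, tq == 0 | w == 0] ->
  has_certificates (persistent X N m) 0 w 0.
Proof.
move=> deg.
(* With no cells at all, any two databases are consistent, so the answer must be shown not to depend
   on the database. *)
have [] := @certificates_of_records _ _ _ (persistent X N m) w 0 0
  void unit (fun _ => of_void _); rewrite ?card_unit //; last first.
  by rewrite card_void => t; rewrite leqn0 => /eqP->.
move=> [q v] d; exists [::] => // d' _; rewrite !persistentE.
have [l lM detl] := exec_determined (query_prog S q) (version_memory (sval d) v).
apply: detl => a al; rewrite /version_memory.
case/or4P: deg => /eqP deg.
- by rewrite !path_updates_nil ?deg // (svalP d, svalP d').
- have z us : run_updates us =1 run_updates [::].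
    move=> b; apply/esym; move: b; apply: dist_eq0; apply/eqP; rewrite -leqn0.
    by have := dist_run_updates [::] us; rewrite deg muln0.
  by rewrite !z.
- have := leq_trans lM (run_query _ q).1.
  by rewrite deg leqn0 => /nilP l0; rewrite l0 in al.
have z (x y : word w) : x = y.
  by apply: eq_from_tnth => i; have := ltn_ord i; rewrite {2}deg.
exact: z.
Qed.

Lemma version_memory_pieces (N : finType) (d : version_tree N (update X))
    (n := #|N|.+1) (B := #|{: word w}| * n) :
  exists (pos : N -> 'I_n)
         (F : 'I_((total_updates d * tu).*2.+1) ->
              'I_B.+1 * 'I_B.+1 * option (word w)),
    (forall i v (a : word w), (F i).1.1 <= enum_rank a * n + pos v <= (F i).1.2 ->
       version_memory d v a = odflt (init_memory S a) (F i).2) /\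
    (forall v (a : word w), exists i, (F i).1.1 <= enum_rank a * n + pos v <= (F i).1.2).
Proof.
have [||pos [s [posn ss sP sc]]] := @memory_pieces N (word w) (word w) (parent d)
  (Defs.root d) (version_memory d) (init_memory S)
  (fun v => size (updates d v) * tu) (root_reachable d).
- rewrite /version_memory path_updates_root.
  exact: dist_run_updates [::] _.
- move=> v vr; rewrite /version_memory (path_updates_parent vr).
  exact: dist_run_updates.
(* Any address would do: [p0] only pads the list of pieces to its full length, harmlessly because it
   is itself a valid piece. *)
have [p0 p0s _] := sc (Defs.root d) [tuple of nseq w false].
pose p_ i := nth p0 s i.
have p_s i : p_ i \in s.
  by have [si|si] := ltnP i (size s); [exact: mem_nth | rewrite /p_ nth_default].
have p_P i := sP _ (p_s i).
exists (fun v => Ordinal (posn v)),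
  (fun i => (inord (p_ i).1.1, inord (p_ i).1.2, (p_ i).2)); split=> [i v a|v a].
  by have [p1 p2 pP] := p_P i; rewrite /= !inordK ?ltnS //; apply: pP.
have [p ps pc] := sc v a.
have iS : index p s < (total_updates d * tu).*2.+1.
  rewrite /total_updates big_distrl; apply: leq_trans ss.
  by rewrite index_mem.
exists (Ordinal iS); have [p1 p2 _] := p_P (index p s).
by rewrite /= !inordK ?ltnS //= /p_ nth_index.
Qed.

(** The hypothesis counts records: a record is a tour position or a piece, that is, two endpoints at
    most [B] and an optional word. A query reads one position and at most [tq] pieces. *)
Lemma persistent_certificates (N : finType) (m k : nat) (n := #|N|.+1)
    (B := #|{: word w}| * n) :
  n + B.+1 * B.+1 * (2 ^ w).+1 <= 2 ^ (k * w) ->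
  exists2 t, t <= tq.+1 * k
    & has_certificates (persistent X N m) ((#|N| + (m * tu).*2.+1) * k) w t.
Proof.
move=> Rk; set I := (N + 'I_((m * tu).*2.+1))%type.
pose R := ('I_n + ('I_B.+1 * 'I_B.+1 * option (word w)))%type.
pose covers (tab : I -> R) v (a : word w) i := exists pos p,
  [/\ tab (inl v) = inl pos, tab (inr i) = inr p
     & p.1.1 <= enum_rank a * n + pos <= p.1.2].
(* The second clause speaks of every stored piece, so a piece read in one database also fixes the
   cell in any other database showing the same records. *)
pose correct (d : {d : version_tree N (update X) | total_updates d = m})
    (tab : I -> R) :=
  (forall v a, exists i, covers tab v a i) /\
  (forall v (a : word w) i pos p, tab (inl v) = inl pos -> tab (inr i) = inr p ->
     p.1.1 <= enum_rank a * n + pos <= p.1.2 ->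
     version_memory (sval d) v a = odflt (init_memory S a) p.2).
have /(_ _)/constructive_indefinite_description tabs d : exists tab, correct d tab.
  have := version_memory_pieces (sval d).
  rewrite (svalP d) => -[pos [F [FP Fc]]].
  exists (fun x => match x with inl v => inl (pos v) | inr i => inr (F i) end).
  split=> [v a|v a i j p [<-] [<-]]; last exact: FP.
  by have [i ic] := Fc v a; exists i, (pos v), (F i).
pose T d := sval (tabs d); have TP d : correct d (T d) := svalP (tabs d).
have -> : #|N| + (m * tu).*2.+1 = #|{: I}| by rewrite card_sum card_ord.
apply: (@certificates_of_records _ _ _ _ _ _ _ _ R T).
  by rewrite card_sum !card_prod !card_ord card_option card_tuple card_bool.
move=> [q v] d; have [lc lP] := TP d.
have [l lM detl] := exec_determined (query_prog S q) (version_memory (sval d) v).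
have {lc} [idx idxP] : exists idx, forall a, covers (T d) v a (idx a).
  pose idx a := sval (constructive_indefinite_description _ (lc v a)).
  by exists idx => a; apply: svalP (constructive_indefinite_description _ _).
exists (inl v :: map (fun a => inr (idx a)) l).
  by rewrite /= size_map ltnS (leq_trans lM) // (run_query _ q).1.
move=> d' eqT; rewrite !persistentE; apply: detl => a al.
have [pos [p [Tv Ti pc]]] := idxP a.
rewrite (lP _ _ _ _ _ Tv Ti pc); have [_ lP'] := TP d'.
apply: (lP' _ _ _ _ _ _ _ pc).
  by rewrite eqT ?mem_head.
rewrite eqT //; first exact: Ti.
by rewrite inE; apply/orP; right; apply/mapP; exists a.
Qed.

End Solution.

(* K and L are the constants of w = Omega(lg m) and of the bound O(m) on the
   number of nodes of the version tree; C depends on K and L only. *)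
Theorem theorem1 (K L : nat) :
  exists C : nat,
  forall (X : dynamic_problem) (w tu tq m : nat) (N : finType)
         (A : data_structure X w),
    solves A tu tq ->
    up_log 2 m <= K * w ->
    #|N| <= L * m.+1 ->
    exists s t : nat,
      [/\ s <= C * (m * tu), t <= C * tq
        & has_certificates (persistent X N m) s w t].
Proof.
(* With [E = 2 ^ (e * w)] and [W = 2 ^ w], the number of tour positions is at most [E]: the part [K]
   of [e] pays for [m], the rest for the factor [L.*2.+1]. An endpoint takes at most [W ^ 2 * E]
   values and an optional word at most [W ^ 2], so there are at most
   [2 * E ^ 2 * W ^ 6 <= E ^ 2 * W ^ 7] records. *)
pose e := L.*2 + K + 1; pose k := e.*2 + 7.
(* For positive [m] and [tu], the summands of [#|N| + (m * tu).*2.+1] are bounded by [L.*2], 2 and 1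
   times [m * tu]. *)
exists (k * (L.*2 + 3)) => X w tu tq m N A solA mw Nm.
have [deg|] := boolP [|| m == 0, tu == 0, tq == 0 | w == 0].
  by exists 0, 0; split=> //; apply: (degenerate_certificates solA).
rewrite !negb_or -!lt0n => /and4P[m0 tu0 tq0 w0].
have Nm2 : #|N| <= L.*2 * m by apply: leq_trans Nm _; nia.
have ne : #|N|.+1 <= 2 ^ (e * w).
  have m2 : m <= 2 ^ (K * w).
    by apply: leq_trans (up_logP m (isT : 1 < 2)) _; rewrite leq_pexp2l.
  have L2 : L.*2.+1 <= 2 ^ ((L.*2 + 1) * w).
    rewrite addn1; apply: leq_trans (ltn_expl _ (isT : 1 < 2)) _.
    by rewrite leq_pexp2l //; nia.
  have -> : e * w = (L.*2 + 1) * w + K * w by rewrite /e; lia.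
  rewrite expnD; apply: leq_trans (leq_mul L2 m2); nia.
have w2 : 2 <= 2 ^ w by rewrite -{1}(expn1 2) leq_pexp2l.
have [|t tk cert] := @persistent_certificates X w tu tq A solA N m k.
  rewrite card_tuple card_bool.
  have -> : 2 ^ (k * w) = (2 ^ (e * w)) ^ 2 * (2 ^ w) ^ 7.
    by rewrite -!expnM -expnD; congr (_ ^ _); rewrite /k; lia.
  have E0 : 0 < 2 ^ (e * w) by rewrite expn_gt0.
  move: E0 ne w2; move: (#|N|.+1) (2 ^ (e * w)) (2 ^ w) => n E W E0 nE W2.
  have WW : W.+1 <= W * W by nia.
  have B2 : (W * n).+1 <= W * W * E by nia.
  have bound := leq_mul (leq_mul B2 B2) WW.
  have EW : E <= E * E * W ^ 6.
    by rewrite -mulnA leq_pmulr // muln_gt0 E0 expn_gt0; lia.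
  apply: leq_trans (leq_add (leq_trans nE EW) bound) _.
  have -> : W * W * E * (W * W * E) * (W * W) = E * E * W ^ 6.
    by rewrite !expnS expn0; lia.
  have -> : E ^ 2 * W ^ 7 = W * (E * E * W ^ 6).
    by rewrite (expnS W 6) -mulnn mulnCA.
  by rewrite addnn -mul2n leq_mul2r W2 orbT.
exists ((#|N| + (m * tu).*2.+1) * k), t; split=> //.
  rewrite mulnC -mulnA leq_mul2l; apply/orP; right.
  have : L.*2 * m <= L.*2 * (m * tu) by rewrite leq_mul2l leq_pmulr ?orbT.
  have : 0 < m * tu by rewrite muln_gt0 m0.
  by lia.
apply: leq_trans tk _; rewrite mulnC -mulnA leq_mul2l; apply/orP; right; nia.
Qed.
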